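(* Let $p$ be an odd prime. There exists a homogeneous system of linear equations over $\mathbb{F}_p$ which is Alon but not Sidorenko. (Explicitly, the system $\Phi$ in the nine variables $x_1,\dots,x_9$ given by $x_1-x_2+x_3-x_4=0$, $x_5-x_6+x_7-x_8+x_9=0$ has this property.)
   Context: A system $\Psi$ is a full-rank homogeneous system of $m$ linear equations in $t>m$ variables with coefficients in $\mathbb{F}_p$, given by an $m\times t$ matrix $M_\Psi$. For $f:\mathbb{F}_p^n\to\mathbb{C}$ define $T_\Psi(f)=\mathbb{E}_{\mathbf{x}\in(\mathbb{F}_p^n)^t:\,M_\Psi\mathbf{x}=0} f(x_1)\cdots f(x_t)$, where $\mathbb{E}$ denotes the uniform average over the indicated finite set. $\Psi$ is common if for all $n\ge1$ and all $f:\mathbb{F}_p^n\to[0,1]$, $T_\Psi(f)+T_\Psi(1-f)\ge 2^{1-t}$. $\Psi$ is Sidorenko if for all $n\ge1$ and all $f:\mathbb{F}_p^n\to[0,1]$, $T_\Psi(f)\ge(\mathbb{E}_{x\in\mathbb{F}_p^n}f(x))^t$. For $l\ge0$, $\Psi^{(l)}$ denotes the system in $t+l$ variables obtained from $\Psi$ by adding $l$ new variables that appear in no equation (free variables). $\Psi$ is Alon if there is $l_0$ such that $\Psi^{(l)}$ is common for all $l\ge l_0$. *)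

(* Defs.v *)
From mathcomp Require Import all_boot all_order all_algebra.
From mathcomp Require Import reals.

Set Implicit Arguments.
Unset Strict Implicit.
Unset Printing Implicit Defensive.

Import Order.TTheory GRing.Theory Num.Theory.
Local Open Scope ring_scope.

Definition average (K : numFieldType) (I : finType) (A : {set I}) (F : I -> K) : K :=
  (\sum_(x in A) F x) / #|A|%:R.

Section Systems.
Variable p : nat.

Definition is_system (m t : nat) (M : 'M['F_p]_(m, t)) : Prop :=
  (m < t)%N /\ \rank M = m.

(* A tuple (x_1, ..., x_t) of vectors of F_p^n is encoded as the t x n matrix
   whose rows are the x_i, so that M x = 0 is a matrix equation. *)
Definition solutions (m t n : nat) (M : 'M['F_p]_(m, t)) : {set 'M['F_p]_(t, n)} :=
  [set x | M *m x == 0].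

Definition T (K : numFieldType) (m t n : nat) (M : 'M['F_p]_(m, t))
    (f : 'rV['F_p]_n -> K) : K :=
  average (solutions n M) (fun x => \prod_(i < t) f (row i x)).

Definition common (R : realType) (m t : nat) (M : 'M['F_p]_(m, t)) : Prop :=
  forall (n : nat) (f : 'rV['F_p]_n -> R), (1 <= n)%N ->
    (forall x, 0 <= f x <= 1) ->
    T M f + T M (fun x => 1 - f x) >= (2 : R) ^ (1 - t%:Z).

Definition sidorenko (R : realType) (m t : nat) (M : 'M['F_p]_(m, t)) : Prop :=
  forall (n : nat) (f : 'rV['F_p]_n -> R), (1 <= n)%N ->
    (forall x, 0 <= f x <= 1) ->
    T M f >= average [set: 'rV['F_p]_n] f ^+ t.

Definition add_free (m t : nat) (M : 'M['F_p]_(m, t)) (l : nat) : 'M['F_p]_(m, t + l) :=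
  row_mx M 0.

Definition alon (R : realType) (m t : nat) (M : 'M['F_p]_(m, t)) : Prop :=
  exists l0 : nat, forall l : nat, (l0 <= l)%N -> common R (add_free M l).

Definition Phi : 'M['F_p]_(2, 9) :=
  \matrix_(i < 2, j < 9)
    nth 0 (nth [::]
      [:: [:: 1; -1; 1; -1; 0;  0; 0;  0; 0];
          [:: 0;  0; 0;  0; 1; -1; 1; -1; 1]] i) j.

End Systems.

Arguments Phi p : clear implicits.

(* Main.v *)
(* For mean-zero g put C g (d) = E_y g(y) g(y+d).  Every density splits as
   f = a + g, and T_Phi(f) = (a^4 + S) (a^5 + Q) with S = CCg(0) and
   Q = E(g CCg), while 1 - f replaces (a, Q) by (1 - a, - Q).  Krein's inequality
   2 h(x)^2 <= h(0) (h(0) + h(2x)) for the positive-definite function h = C g,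
   averaged over x (p is odd, so doubling is bijective), gives
   2 E (C g)^2 <= (E g^2)^2.  Applied to g and to C g this bounds S by
   (a (1 - a))^2 / 2 and Q^2 by a (1 - a) S^2 / 2, in place of a Fourier
   argument.  These two bounds already imply commonness once there are many
   free variables.  Not Sidorenko: the indicator of the point 1 of F_p has
   T = 0, because the second equation has coefficient sum 1. *)
Require Import Defs.
From mathcomp Require Import all_boot all_order all_algebra.
From mathcomp Require Import reals.
From mathcomp Require Import ring lra.

Set Implicit Arguments.
Unset Strict Implicit.
Unset Printing Implicit Defensive.

Import Order.TTheory GRing.Theory Num.Theory.
Local Open Scope ring_scope.

(** * Uniform averages over a finite abelian group *)

Section Mean.
Variables (R : realFieldType) (V : finZmodType).
Implicit Types (F G : V -> R) (c : R).

Definition mean F : R := (\sum_x F x) / #|V|%:R.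

Lemma card_neq0 : #|V|%:R != 0 :> R.
Proof. by rewrite pnatr_eq0 -lt0n; apply/card_gt0P; exists 0. Qed.

Lemma eq_mean F G : F =1 G -> mean F = mean G.
Proof. by move=> eqFG; rewrite /mean (eq_bigr G). Qed.

Lemma meanD F G : mean (fun x => F x + G x) = mean F + mean G.
Proof. by rewrite /mean big_split mulrDl. Qed.

Lemma meanZ c F : mean (fun x => c * F x) = c * mean F.
Proof. by rewrite /mean -mulr_sumr mulrA. Qed.

Lemma mean_cst c : mean (fun=> c) = c.
Proof. by rewrite /mean sumr_const -[c *+ _]mulr_natr mulfK // card_neq0. Qed.

Lemma mean_ge0 F : (forall x, 0 <= F x) -> 0 <= mean F.
Proof. by move=> F0; rewrite divr_ge0 ?ler0n// sumr_ge0. Qed.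

Lemma le_mean F G : (forall x, F x <= G x) -> mean F <= mean G.
Proof.
by move=> leFG; rewrite ler_wpM2r ?invr_ge0 ?ler0n// ler_sum.
Qed.

Lemma mean_inj (h : V -> V) F : injective h -> mean (fun x => F (h x)) = mean F.
Proof. by move=> h_inj; rewrite /mean [in RHS](reindex_inj h_inj). Qed.

Lemma mean_shift d F : mean (fun x => F (x + d)) = mean F.
Proof. exact/mean_inj/addIr. Qed.

Lemma exchange_mean (F : V -> V -> R) :
  mean (fun x => mean (F x)) = mean (fun y => mean (fun x => F x y)).
Proof. by rewrite /mean -!mulr_suml exchange_big. Qed.

Lemma mean_sqr_ge0 F : 0 <= mean (fun x => F x ^+ 2).
Proof. by apply: mean_ge0 => x; exact: sqr_ge0. Qed.

(** Lagrange's identity: the double average of [(F x * G y - F y * G x) ^+ 2] is twice the right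
    side minus the left. *)
Lemma mean_CauchySchwarz F G :
  mean (fun x => F x * G x) ^+ 2
    <= mean (fun x => F x ^+ 2) * mean (fun x => G x ^+ 2).
Proof.
set a := mean (fun x => F x * G x).
set b := mean (fun x => F x ^+ 2); set d := mean (fun x => G x ^+ 2).
have inner x : mean (fun y => (F x * G y - F y * G x) ^+ 2) =
    d * F x ^+ 2 + (- (2 * a) * (F x * G x) + b * G x ^+ 2).
  rewrite (eq_mean (G := fun y => F x ^+ 2 * G y ^+ 2 +
    (- (2 * F x * G x) * (F y * G y) + G x ^+ 2 * F y ^+ 2))).
    by rewrite !meanD !meanZ -/a -/b -/d; ring.
  by move=> y; ring.
have : 0 <= mean (fun x => mean (fun y => (F x * G y - F y * G x) ^+ 2)).
  by apply: mean_ge0 => x; exact: mean_sqr_ge0.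
rewrite (eq_mean inner) !meanD !meanZ -/a -/b -/d => h.
by rewrite -subr_ge0; lra.
Qed.

(** * Autocorrelations *)

Definition autocorr F (d : V) : R := mean (fun y => F y * F (y + d)).

Lemma eq_autocorr F G : F =1 G -> autocorr F =1 autocorr G.
Proof. by move=> eqFG d; apply: eq_mean => y; rewrite !eqFG. Qed.

Lemma autocorr0 F : autocorr F 0 = mean (fun x => F x ^+ 2).
Proof. by apply: eq_mean => y; rewrite addr0. Qed.

Lemma autocorrN F : autocorr (fun x => - F x) =1 autocorr F.
Proof. by move=> d; apply: eq_mean => y; rewrite mulrNN. Qed.

(** In particular mean zero passes from [F] to [autocorr F], which lets the bounds below be
    iterated. *)
Lemma mean_autocorr F : mean (autocorr F) = mean F ^+ 2.
Proof.
rewrite /autocorr exchange_mean.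
under eq_mean => y.
  rewrite meanZ (eq_mean (G := fun x => F (x + y))); last by move=> x; rewrite addrC.
  rewrite mean_shift mulrC; over.
by rewrite meanZ.
Qed.

Lemma autocorr_addl c F : mean F = 0 ->
  autocorr (fun x => c + F x) =1 (fun d => c ^+ 2 + autocorr F d).
Proof.
move=> F0 d; rewrite /autocorr.
rewrite (eq_mean (G := fun y => c ^+ 2 +
  (c * F y + (c * F (y + d) + F y * F (y + d))))); last by move=> y; ring.
by rewrite !meanD !meanZ mean_shift F0 mean_cst mulr0 !add0r.
Qed.

(* Krein's inequality for the positive-definite function [autocorr F]. *)
Lemma autocorr_double F (x : V) :
  2 * autocorr F x ^+ 2 <= autocorr F 0 * (autocorr F 0 + autocorr F (x + x)).
Proof.
(* With [h = autocorr F], pairing [F] with the sum of its two translates gives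
   [(2 h(x))^2 <= h(0) * 2 (h(0) + h(2x))]. *)
have := mean_CauchySchwarz F (fun y => F (y + x) + F (y - x)).
have -> : mean (fun y => F y * (F (y + x) + F (y - x))) = 2 * autocorr F x.
  under eq_mean => y do rewrite mulrDr.
  rewrite meanD -[X in _ + X](mean_shift x).
  rewrite [X in _ + X](eq_mean (G := fun y => F y * F (y + x))); last first.
    by move=> y; rewrite addrK mulrC.
  by rewrite -/(autocorr F x); ring.
have -> : mean (fun y => (F (y + x) + F (y - x)) ^+ 2) =
    2 * (autocorr F 0 + autocorr F (x + x)).
  rewrite (eq_mean (G := fun y => F (y + x) ^+ 2 +
    (F (y - x) ^+ 2 + 2 * (F (y - x) * F (y + x))))); last by move=> y; ring.
  rewrite !meanD meanZ (mean_shift x (fun y => F y ^+ 2)).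
  rewrite (mean_shift (- x) (fun y => F y ^+ 2)) -autocorr0.
  rewrite -(mean_shift x (fun y => F (y - x) * F (y + x))).
  rewrite [X in _ + (_ + 2 * X)](eq_mean (G := fun y => F y * F (y + (x + x)))).
    by rewrite -/(autocorr F (x + x)); ring.
  by move=> y; rewrite addrK addrA.
by rewrite -autocorr0 => h; lra.
Qed.

(** Doubling permutes the group, so the term [autocorr F (x + x)] averages to [mean F ^+ 2 = 0]. *)
Lemma mean_autocorr_sqr F : injective (fun x : V => x + x) -> mean F = 0 ->
  2 * mean (fun x => autocorr F x ^+ 2) <= mean (fun x => F x ^+ 2) ^+ 2.
Proof.
move=> dbl_inj F0; rewrite -meanZ.
apply: le_trans (le_mean (autocorr_double F)) _.
rewrite meanZ meanD mean_cst (mean_inj (autocorr F) dbl_inj) mean_autocorr F0.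
by rewrite autocorr0 expr0n /= addr0 expr2.
Qed.

Lemma sum_mean F : \sum_x F x = #|V|%:R * mean F.
Proof. by rewrite mulrC divfK// card_neq0. Qed.

(** For fixed [d] the sums over [a] and [b] separate, each giving [autocorr F d] up to
    normalization. *)
Lemma sum_additive_quadruples F :
  \sum_d \sum_a \sum_b (F a * F (a + d)) * (F b * F (b + d)) =
    #|V|%:R ^+ 3 * autocorr (autocorr F) 0.
Proof.
rewrite autocorr0 [_ ^+ 3]exprSr -mulrA -sum_mean mulr_sumr.
apply: eq_bigr => d _.
by rewrite -big_distrlr /= !sum_mean -/(autocorr F d); ring.
Qed.

(** For fixed [z] and [e] the sums over [c] and [k] separate into [autocorr F e] and
    [autocorr F (e + z)]; summing over [e] correlates these. *)
Lemma sum_additive_quintuples F :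
  \sum_z \sum_e \sum_c \sum_k
    F z * ((F c * F (c + e)) * (F k * F (k + (e + z)))) =
  #|V|%:R ^+ 4 * mean (fun z => F z * autocorr (autocorr F) z).
Proof.
rewrite [_ ^+ 4]exprSr -mulrA -sum_mean mulr_sumr; apply: eq_bigr => z _.
have -> : #|V|%:R ^+ 3 * (F z * autocorr (autocorr F) z) =
    F z * #|V|%:R ^+ 2 * (#|V|%:R * autocorr (autocorr F) z) by ring.
rewrite [autocorr (autocorr F) z]/autocorr -sum_mean mulr_sumr.
apply: eq_bigr => e _.
under eq_bigr => c _ do rewrite -mulr_sumr.
rewrite -mulr_sumr -big_distrlr /= !sum_mean -/(autocorr F e).
by rewrite -/(autocorr F (e + z)); ring.
Qed.

End Mean.

(** * The real inequality behind commonness *)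

Section Inequality.
Variable R : realFieldType.
Implicit Types (x e a b s q : R).

Lemma Bernoulli x k : -1 <= x -> 1 + k%:R * x <= (1 + x) ^+ k.
Proof.
move=> x_ge; elim: k => [|k IHk]; first by rewrite mul0r addr0 expr0.
have k_ge0 : 0 <= k%:R :> R by exact: ler0n.
rewrite exprS -natr1; apply: le_trans (ler_wpM2l _ IHk); last by lra.
by have := mulr_ge0 k_ge0 (sqr_ge0 x); nra.
Qed.

Lemma two_power_sum e k : 0 <= e <= 1 -> 2 <= (1 + e) ^+ k + (1 - e) ^+ k.
Proof.
move=> /andP[e0 e1].
have := @Bernoulli e k ltac:(lra); have := @Bernoulli (- e) k ltac:(lra).
by lra.
Qed.

(* As [k] grows, [(1 + e) ^+ k] is large unless [e] is so small that
   [(1 - e ^+ 2) ^+ k] is close to 1, and then AM-GM applies. *)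
Lemma two_weighted_power_sum e k : (100 <= k)%N -> 0 <= e <= 1 ->
  2 <= 9 / 10 * (1 + e) ^+ k + 3 / 2 * (1 - e) ^+ k.
Proof.
move=> k100 /andP[e0 e1].
have k_ge : 100 <= k%:R :> R by rewrite (ler_nat R 100).
have Xge := @Bernoulli e k ltac:(lra).
have XYge := @Bernoulli (- e ^+ 2) k ltac:(nra).
have XYE : (1 - e ^+ 2) ^+ k = (1 + e) ^+ k * (1 - e) ^+ k.
  by rewrite -exprMn; congr (_ ^+ _); ring.
have Yge0 : 0 <= (1 - e) ^+ k by rewrite exprn_ge0//; lra.
move: Xge XYge; rewrite XYE.
set X := (1 + e) ^+ k in XYE *; set Y := (1 - e) ^+ k in XYE Yge0 *.
move=> Xge XYge.
(* From [20 / 9] on the first term alone reaches 2. Below it, Bernoulli gives [k e < 11 / 9], and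
   [k >= 100] then makes [k e^2] at most [3 / 200]. *)
have [X_ge|X_lt] := leP (20 / 9) X; first by lra.
have ke0 : 0 <= k%:R * e by rewrite mulr_ge0//; lra.
have ke2 : (k%:R * e) * (k%:R * e) <= 3 / 2.
  apply: le_trans (_ : (11 / 9) * (11 / 9) <= _); last by lra.
  by apply: ler_pM => //; lra.
have ke : k%:R * e ^+ 2 <= 3 / 200.
  have : 100 * (k%:R * e ^+ 2) <= k%:R * (k%:R * e ^+ 2).
    by apply: ler_wpM2r => //; rewrite mulr_ge0 ?sqr_ge0//; lra.
  have -> : k%:R * (k%:R * e ^+ 2) = (k%:R * e) * (k%:R * e) by ring.
  by lra.
have XY : 97 / 100 <= X * Y by lra.
(* By AM-GM the squared right side is at least [4 * (27 / 20) * X * Y], which exceeds 4. *)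
rewrite -(@ler_pXn2r _ 2) ?nnegrE//; last by lra.
have := sqr_ge0 (9 / 10 * X - 3 / 2 * Y).
by nra.
Qed.

(** Rescaling: with [e = a - b], the numbers [a] and [b] are [(1 + e) / 2] and [(1 - e) / 2]. *)
Lemma two_weighted_power_sum_half (c d : R) a b k :
  (forall e, 0 <= e <= 1 -> 2 <= c * (1 + e) ^+ k + d * (1 - e) ^+ k) ->
  a + b = 1 -> 0 <= b <= a -> 2 * 2^-1 ^+ k <= c * a ^+ k + d * b ^+ k.
Proof.
move=> H ab /andP[b0 ba].
pose e := a - b.
have /H h : 0 <= e <= 1 by apply/andP; split; rewrite /e; lra.
have -> : a = 2^-1 * (1 + e) by rewrite /e; lra.
have -> : b = 2^-1 * (1 - e) by rewrite /e; lra.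
rewrite !exprMn.
have h2 : 0 <= 2^-1 ^+ k :> R by rewrite exprn_ge0// invr_ge0.
have := ler_wpM2l h2 h.
by lra.
Qed.

(** The unfavourable sign, where the odd term lowers the larger side. After scaling by powers of
    [a], the [a]-term is exactly [(1 + u) (1 - v) a^(9 + l)], and since [b <= a] the [b]-term is at
    least [(1 + u) (1 + v) b^(9 + l)]. *)
Lemma weighted_ineq a b s q l : (100 <= l)%N -> a + b = 1 -> 0 <= b <= a ->
  0 <= s -> 0 <= q -> 2 * s <= (a * b) ^+ 2 -> 2 * q ^+ 2 <= (a * b) * s ^+ 2 ->
  2 * 2^-1 ^+ (9 + l) <=
    a ^+ l * ((a ^+ 4 + s) * (a ^+ 5 - q)) + b ^+ l * ((b ^+ 4 + s) * (b ^+ 5 + q)).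
Proof.
move=> l100 ab ba' s0 q0 sle qle; have /andP[b0 ba] := ba'.
have a_gt0 : 0 < a by lra.
have abaa : 0 <= a * b <= a ^+ 2 by apply/andP; split; nra.
pose u := s / a ^+ 4; pose v := q / a ^+ 5.
have a4 : 0 < a ^+ 4 by rewrite exprn_gt0.
have a5 : 0 < a ^+ 5 by rewrite exprn_gt0.
have sE : s = u * a ^+ 4 by rewrite /u divfK// gt_eqF.
have qE : q = v * a ^+ 5 by rewrite /v divfK// gt_eqF.
have u0 : 0 <= u by rewrite divr_ge0// ltW.
have v0 : 0 <= v by rewrite divr_ge0// ltW.
have u_le : u <= 1 / 2.
  rewrite /u ler_pdivrMr//.
  have : (a * b) ^+ 2 <= (a ^+ 2) ^+ 2.
    by case/andP: abaa => *; rewrite lerXn2r ?nnegrE ?sqr_ge0.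
  by rewrite -exprM; lra.
(* The hypothesis on [q] gives [2 v^2 <= u^2], and [71 / 100] is a rational number just above
   [1 / sqrt 2]. *)
have v_le : v <= 71 / 100 * u.
  have u71 : 0 <= 71 / 100 * u by lra.
  rewrite -(@ler_pXn2r _ 2) ?nnegrE//.
  have : 2 * q ^+ 2 <= a ^+ 2 * s ^+ 2.
    apply: le_trans qle _; rewrite ler_wpM2r ?sqr_ge0//.
    by case/andP: abaa.
  rewrite sE qE (_ : 2 * _ = (2 * v ^+ 2) * a ^+ 10); last by ring.
  rewrite (_ : a ^+ 2 * _ = u ^+ 2 * a ^+ 10); last by ring.
  rewrite ler_pM2r ?exprn_gt0// exprMn.
  by have := sqr_ge0 u; lra.
have b4 : 0 <= b ^+ 4 <= a ^+ 4 by rewrite exprn_ge0// lerXn2r// nnegrE ltW.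
have b5 : 0 <= b ^+ 5 <= a ^+ 5 by rewrite exprn_ge0// lerXn2r// nnegrE ltW.
have bterm : (1 + u) * (1 + v) * b ^+ (9 + l) <=
    b ^+ l * ((b ^+ 4 + s) * (b ^+ 5 + q)).
  rewrite exprD (_ : _ * (_ * _) =
    b ^+ l * (((1 + u) * b ^+ 4) * ((1 + v) * b ^+ 5))); last by ring.
  case/andP: b4 => ? ?; case/andP: b5 => ? ?.
  rewrite ler_wpM2l ?exprn_ge0// ler_pM ?mulr_ge0//; try lra.
    by rewrite sE; nra.
  by rewrite qE; nra.
have aterm : a ^+ l * ((a ^+ 4 + s) * (a ^+ 5 - q)) =
    (1 + u) * (1 - v) * a ^+ (9 + l).
  by rewrite sE qE exprD; ring.
have aN : 0 <= a ^+ (9 + l) by rewrite exprn_ge0// ltW.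
have bN : 0 <= b ^+ (9 + l) by rewrite exprn_ge0.
rewrite aterm; apply: le_trans (lerD (lexx _) bterm).
have uv0 : 0 <= u * v by rewrite mulr_ge0.
(* When the [a]-term loses against [a ^+ (9 + l)], it loses at most a tenth, and
   then [u] and [v] are so large that the [b]-term gains a factor 3/2. *)
have [uv|uv] := leP 1 ((1 + u) * (1 - v)).
  apply: (@le_trans _ _ (1 * a ^+ (9 + l) + 1 * b ^+ (9 + l))).
    apply: two_weighted_power_sum_half => // e e01.
    by rewrite !mul1r two_power_sum.
  by rewrite lerD// ler_wpM2r//; nra.
apply: (@le_trans _ _ (9 / 10 * a ^+ (9 + l) + 3 / 2 * b ^+ (9 + l))).
  apply: two_weighted_power_sum_half => // e e01.
  by rewrite two_weighted_power_sum// (leq_trans l100) ?leq_addl.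
(* With [v <= 71 / 100 * u], a product below 1 forces [u > 29 / 71], and then [1 - v < 5 / 7]. The
   bound [u <= 1 / 2] keeps the product above [9 / 10]. *)
have u_ge : 2 / 5 <= u by nra.
have v_ge : 1 / 10 <= v by nra.
by rewrite lerD// ler_wpM2r//; nra.
Qed.

(** Exchanging [a] with [b] and [Q] with [- Q] is a symmetry, so [b <= a] may be assumed. If
    [Q >= 0], the excess over [a^(9 + l) + b^(9 + l)] is a sum of nonnegative terms; negative [Q] is
    the weighted case. *)
Lemma common_ineq a b s (Q : R) l : (100 <= l)%N -> a + b = 1 ->
  0 <= a -> 0 <= b -> 0 <= s ->
  2 * s <= (a * b) ^+ 2 -> 2 * Q ^+ 2 <= (a * b) * s ^+ 2 ->
  2 * 2^-1 ^+ (9 + l) <=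
    a ^+ l * ((a ^+ 4 + s) * (a ^+ 5 + Q)) + b ^+ l * ((b ^+ 4 + s) * (b ^+ 5 - Q)).
Proof.
move=> l100; wlog ba : a b Q / b <= a.
  move=> H ab a0 b0 s0 sle Qle; have [ba|/ltW ba] := leP b a; first exact: H.
  have := H b a (- Q); rewrite sqrrN opprK [b * a]mulrC [b + a]addrC.
  by move=> H'; rewrite [leRHS]addrC; apply: H'.
move=> ab a0 b0 s0 sle Qle; have [Q0|/ltW Q0] := leP 0 Q; last first.
  have := @weighted_ineq a b s (- Q) l; rewrite sqrrN opprK oppr_ge0 b0 ba.
  exact.
apply: (@le_trans _ _ (1 * a ^+ (9 + l) + 1 * b ^+ (9 + l))).
  apply: two_weighted_power_sum_half; rewrite ?b0// => e e01.
  by rewrite !mul1r two_power_sum.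
have lel : 0 <= b ^+ l <= a ^+ l by rewrite exprn_ge0// lerXn2r// nnegrE.
have lel4 : 0 <= b ^+ l * b ^+ 4 <= a ^+ l * a ^+ 4.
  by rewrite -!exprD exprn_ge0// lerXn2r// nnegrE.
have h5 : 0 <= a ^+ l * a ^+ 5 + b ^+ l * b ^+ 5.
  by rewrite addr_ge0// mulr_ge0// exprn_ge0.
case/andP: lel => _ lel; case/andP: lel4 => _ lel4.
rewrite !mul1r !exprD -subr_ge0.
have -> : a ^+ l * ((a ^+ 4 + s) * (a ^+ 5 + Q)) +
    b ^+ l * ((b ^+ 4 + s) * (b ^+ 5 - Q)) -
    (a ^+ 9 * a ^+ l + b ^+ 9 * b ^+ l) =
  s * (a ^+ l * a ^+ 5 + b ^+ l * b ^+ 5) +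
  Q * (a ^+ l * a ^+ 4 - b ^+ l * b ^+ 4) + s * Q * (a ^+ l - b ^+ l).
  by ring.
by rewrite !addr_ge0 ?mulr_ge0// subr_ge0.
Qed.

End Inequality.

(** * Counting solutions: free variables and the system [Phi] *)

Section Counting.
Variables (R : realFieldType) (p n : nat).
Implicit Type f : 'rV['F_p]_n -> R.

(** The unnormalized [T]; its value at the constant 1 is the number of solutions, so one formula
    yields numerator and denominator. *)
Definition weight m t (M : 'M['F_p]_(m, t)) f : R :=
  \sum_(x in solutions n M) \prod_(i < t) f (row i x).

Lemma T_weight m t (M : 'M['F_p]_(m, t)) f : T M f = weight M f / weight M (fun=> 1).
Proof.
rewrite /T /average /weight; congr (_ / _).
by rewrite (eq_bigr (fun=> 1)) ?sumr_const// => x _; rewrite big1.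
Qed.

Lemma eq_T m t (M : 'M['F_p]_(m, t)) f g : f =1 g -> T M f = T M g.
Proof.
move=> eqfg; rewrite !T_weight; congr (_ / _); apply: eq_bigr => x _.
by apply: eq_bigr => i _; rewrite eqfg.
Qed.

Lemma sum_col_mx (t l : nat) (F : 'M['F_p]_(t + l, n) -> R) :
  \sum_x F x = \sum_(y : 'M_(t, n)) \sum_(z : 'M_(l, n)) F (col_mx y z).
Proof.
rewrite pair_big /= (reindex (fun u => col_mx u.1 u.2)) //.
exists (fun x => (usubmx x, dsubmx x)) => [[y z]|x] _ /=.
  by rewrite col_mxKu col_mxKd.
by rewrite vsubmxK.
Qed.

Lemma sum_prod_row l f :
  \sum_(z : 'M_(l, n)) \prod_(i < l) f (row i z) = (\sum_v f v) ^+ l.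
Proof.
elim: l => [|l IHl].
  rewrite expr0 (eq_bigr (fun=> 1)) => [|x _]; last by rewrite big_ord0.
  rewrite sumr_const (eq_card1 (x := 0)) // => x; rewrite inE.
  by apply/esym/eqP/matrixP => -[].
rewrite (@sum_col_mx 1 l (fun x => \prod_(i < 1 + l) f (row i x))) exprS -IHl mulr_suml.
apply: eq_bigr => v _; rewrite mulr_sumr; apply: eq_bigr => z _.
rewrite (@big_split_ord _ _ _ 1 l) big_ord1 rowKu.
rewrite (_ : row ord0 v = v); last by apply/rowP => j; rewrite mxE (ord1 ord0).
by congr (_ * _); apply: eq_bigr => i _; rewrite rowKd.
Qed.

(** Zero columns impose no condition, so the last [l] rows are summed independently. *)
Lemma weight_add_free m t (M : 'M['F_p]_(m, t)) l f :
  weight (add_free M l) f = weight M f * (\sum_v f v) ^+ l.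
Proof.
rewrite /weight big_mkcond sum_col_mx [in RHS]big_mkcond mulr_suml /=.
apply: eq_bigr => y _.
have mem z : (col_mx y z \in solutions n (add_free M l)) = (y \in solutions n M).
  by rewrite !inE mul_row_col mul0mx addr0.
under eq_bigr => z _ do rewrite mem.
case: (y \in _); last by rewrite big1 ?mul0r.
rewrite -sum_prod_row mulr_sumr; apply: eq_bigr => z _.
rewrite big_split_ord /=; congr (_ * _); apply: eq_bigr => i _.
  by rewrite rowKu.
by rewrite rowKd.
Qed.

Lemma T_add_free m t (M : 'M['F_p]_(m, t)) l f :
  T (add_free M l) f = mean f ^+ l * T M f.
Proof.
rewrite !T_weight !weight_add_free invfM mulrACA mulrC; congr (_ * _).
by rewrite /mean exprMn exprVn sumr_const.
Qed.

Let V := 'rV['F_p]_n.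

(* The nine rows of a solution of [Phi] in terms of seven free parameters, chosen
   so that the product of the values of f groups into autocorrelations. *)
Definition Phi_row (u : (V * V * V) * (V * V * V * V)) (i : nat) : V :=
  let: ((d, a, b), (z, e, c, k)) := u in
  nth 0 [:: a; a + d; b + d; b; c + e; c; k; k + (e + z); z] i.

Definition Phi_solution u : 'M['F_p]_(9, n) :=
  \matrix_(i < 9, j < n) Phi_row u i 0 j.

(** Rows are given by a function on [nat] so that the criterion serves arbitrary, parametrized and
    constant rows alike. *)
Lemma mem_solutions_Phi (x : 'M['F_p]_(9, n)) (r : nat -> 'rV['F_p]_n) :
  (forall i : 'I_9, row i x = r i) ->
  (x \in solutions n (Phi p)) =
    (r 0%N - r 1%N + r 2%N - r 3%N == 0) &&
    (r 4%N - r 5%N + r 6%N - r 7%N + r 8%N == 0).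
Proof.
move=> rE; rewrite inE.
have rowE (i : 'I_2) : row i (Phi p *m x) = \sum_j Phi p i j *: r j.
  rewrite row_mul mulmx_sum_row; apply: eq_bigr => j _.
  by rewrite rE mxE.
have Phi0 : row 0 (Phi p *m x) = r 0%N - r 1%N + r 2%N - r 3%N.
  rewrite rowE !big_ord_recl big_ord0 !mxE /= /bump /=.
  by rewrite !scale0r !scale1r !scaleN1r !addr0 !addrA.
have Phi1 : row 1 (Phi p *m x) = r 4%N - r 5%N + r 6%N - r 7%N + r 8%N.
  rewrite rowE !big_ord_recl big_ord0 !mxE /= /bump /=.
  by rewrite !scale0r !scale1r !scaleN1r !add0r !addr0 !addrA.
rewrite -Phi0 -Phi1; apply/eqP/andP => [->|[/eqP x0 /eqP x1]].
  by rewrite !row0 !eqxx.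
apply/row_matrixP => i; rewrite row0.
have [->|->] // : i = 0 \/ i = 1.
by case: i => [[|[|//]] ?]; [left|right]; apply: val_inj.
Qed.

Lemma row_Phi_solution u (i : 'I_9) : row i (Phi_solution u) = Phi_row u i.
Proof. by apply/rowP => j; rewrite !mxE. Qed.

Lemma sum_pair (A B : finType) (F : A * B -> R) :
  \sum_u F u = \sum_a \sum_b F (a, b).
Proof. by rewrite pair_big; apply: eq_bigr => -[]. Qed.

Lemma weight_Phi f : weight (Phi p) f = #|V : finZmodType|%:R ^+ 7 *
  (autocorr (autocorr f) 0 * mean (fun z => f z * autocorr (autocorr f) z)).
Proof.
(* The inverse of [Phi_solution] on solutions: differences and single rows recover the seven
   parameters. *)
pose params (x : 'M['F_p]_(9, n)) : (V * V * V) * (V * V * V * V) :=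
  let r i := row (inord i) x in
  ((r 1%N - r 0%N, r 0%N, r 3%N), (r 8%N, r 4%N - r 5%N, r 5%N, r 6%N)).
have rowE (x : 'M['F_p]_(9, n)) (i : 'I_9) : row i x = row (inord i) x.
  by rewrite inord_val.
rewrite /weight (reindex_onto Phi_solution params) => [|x]; last first.
  rewrite (@mem_solutions_Phi x (fun i => row (inord i) x))//.
  move=> /andP[/eqP eq1 /eqP eq2].
  apply/row_matrixP => i; rewrite row_Phi_solution /params [RHS]rowE.
  (* Counting from 0, only rows 2 and 7 need the equations, one each. *)
  case: i => [[|[|[|[|[|[|[|[|[|//]]]]]]]]] ? /=] //.
  - by rewrite addrC subrK.
  - move/eqP: eq1; rewrite subr_eq0 => /eqP <-.
    by rewrite addrAC addrA subrK subrr add0r.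
  - by rewrite addrC subrK.
  - move/eqP: eq2; rewrite addrAC subr_eq0 => /eqP <-.
    by rewrite addrCA addrA.
rewrite (eq_bigl predT) => [|u]; last first.
  rewrite (mem_solutions_Phi (row_Phi_solution u)) /params !row_Phi_solution !inordK//.
  case: u => [[[d a] b] [[[z e] c] k]] /=.
  apply/andP; split; last first.
    by rewrite ![a + d]addrC ![c + e]addrC !addrK.
  apply/andP; split.
    by rewrite opprD [a + (- a - d)]addrA subrr add0r [b + d]addrC addKr subrr.
  rewrite [c + e]addrC addrK (addrCA k) [e + (k + z)]addrA opprD.
  by rewrite [e + k + (_ - z)]addrA subrr add0r addNr.
pose F1 (u : V * V * V) := let: (d, a, b) := u in
  (f a * f (a + d)) * (f b * f (b + d)).
pose F2 (u : V * V * V * V) := let: (z, e, c, k) := u in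
  f z * ((f c * f (c + e)) * (f k * f (k + (e + z)))).
rewrite (eq_bigr (fun u => F1 u.1 * F2 u.2)) => [|u _]; last first.
  under eq_bigr => i _ do rewrite row_Phi_solution.
  case: u => [[[d a] b] [[[z e] c] k]].
  rewrite !big_ord_recl big_ord0 /= /bump /=; ring.
rewrite sum_pair -big_distrlr /=.
rewrite !sum_pair /= sum_additive_quadruples sum_additive_quintuples.
by ring.
Qed.

Lemma T_Phi f : T (Phi p) f =
  autocorr (autocorr f) 0 * mean (fun z => f z * autocorr (autocorr f) z).
Proof.
rewrite T_weight !weight_Phi.
(* Autocorrelations of the constant 1 are 1, so the denominator is [#|V| ^+ 7] and cancels. *)
have auto1 (g : V -> R) : g =1 (fun=> 1) -> autocorr g =1 (fun=> 1).
  by move=> g1 d; rewrite (eq_autocorr g1) /autocorr mul1r mean_cst.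
have a1 := auto1 _ (auto1 _ (frefl (fun=> 1))).
rewrite a1 (@eq_mean R V (fun z => 1 * _) (fun=> 1)) => [|z]; last first.
  by rewrite a1 mul1r.
by rewrite mean_cst !mulr1 mulrC mulKf// expf_neq0// card_neq0.
Qed.

End Counting.

(** * [Phi] with free variables is common *)

Lemma autocorr2_addl (R : realFieldType) (V : finZmodType) (c : R) (g : V -> R) :
  mean g = 0 ->
  autocorr (autocorr (fun x => c + g x)) =1
    (fun d => c ^+ 4 + autocorr (autocorr g) d).
Proof.
move=> g0 d; rewrite (eq_autocorr (autocorr_addl c g0)) autocorr_addl.
  by rewrite -exprM.
by rewrite mean_autocorr g0 expr0n.
Qed.

(** The cross terms vanish because both [g] and its iterated autocorrelation have mean zero. *)
Lemma T_Phi_addl (R : realFieldType) (p n : nat) (c : R) (g : 'rV['F_p]_n -> R) :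
  mean g = 0 ->
  T (Phi p) (fun x => c + g x) = (c ^+ 4 + autocorr (autocorr g) 0) *
    (c ^+ 5 + mean (fun z => g z * autocorr (autocorr g) z)).
Proof.
move=> g0; rewrite T_Phi autocorr2_addl//; congr (_ * _).
rewrite (@eq_mean R 'rV['F_p]_n _ (fun z => c ^+ 5 + (c ^+ 4 * g z +
  (c * autocorr (autocorr g) z + g z * autocorr (autocorr g) z)))).
  by rewrite !meanD !meanZ mean_cst g0 !mean_autocorr g0 !expr0n /=; ring.
by move=> z; rewrite autocorr2_addl//; ring.
Qed.

Lemma double_inj (p n : nat) : prime p -> odd p ->
  injective (fun x : 'rV['F_p]_n => x + x).
Proof.
move=> p_pr p_odd x y /rowP eqxy; apply/rowP => j.
have two_neq0 : 2%:R != 0 :> 'F_p.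
  rewrite -(dvdn_pcharf (pchar_Fp p_pr)) dvdn_prime2//.
  by apply: contraTneq p_odd => ->.
apply: (mulfI two_neq0).
by have := eqxy j; rewrite !mxE !mulr_natl !mulr2n.
Qed.

Lemma alon_Phi (R : realType) (p : nat) : prime p -> odd p -> alon R (Phi p).
Proof.
move=> p_pr p_odd; exists 100%N => l l100 n f _ f01.
pose a := mean f; pose g x := f x - a.
have g0 : mean g = 0.
  by rewrite /g (meanD f (fun=> - a)) mean_cst subrr.
have Ng0 : mean (fun x => - g x) = 0.
  rewrite (@eq_mean R 'rV['F_p]_n _ (fun x => (-1) * g x)).
    by rewrite meanZ g0 mulr0.
  by move=> x; rewrite mulN1r.
pose b := 1 - a.
pose S := autocorr (autocorr g) 0.
pose Q := mean (fun z => g z * autocorr (autocorr g) z).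
have fE : f =1 (fun x => a + g x) by move=> x; rewrite /g addrC subrK.
have f'E : (fun x => 1 - f x) =1 (fun x => b + - g x).
  by move=> x; rewrite /g /b; ring.
have mean_f' : mean (fun x => 1 - f x) = b.
  by rewrite (@eq_mean R 'rV['F_p]_n _ _ f'E) meanD mean_cst Ng0 addr0.
have Tf : T (Phi p) f = (a ^+ 4 + S) * (a ^+ 5 + Q).
  by rewrite (eq_T _ fE) T_Phi_addl.
(* Autocorrelation is even in [g], so [S] is unchanged, while [Q] has one further factor [g] and
   changes sign. *)
have NgE : autocorr (autocorr (fun x => - g x)) =1 autocorr (autocorr g).
  exact/eq_autocorr/autocorrN.
have Tf' : T (Phi p) (fun x => 1 - f x) = (b ^+ 4 + S) * (b ^+ 5 - Q).
  rewrite (eq_T _ f'E) T_Phi_addl// NgE -/S; congr (_ * (_ + _)).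
  rewrite /Q -mulN1r -meanZ; apply: eq_mean => z.
  by rewrite NgE mulN1r mulNr.
have a_ge0 : 0 <= a by apply: mean_ge0 => x; case/andP: (f01 x).
have b_ge0 : 0 <= b.
  by rewrite -mean_f'; apply: mean_ge0 => x; case/andP: (f01 x); rewrite subr_ge0.
(* The variance bound for values in [[0, 1]], from [f^2 <= f] pointwise. *)
have varg : mean (fun x => g x ^+ 2) <= a * b.
  have -> : a * b = mean (fun x => (1 - 2 * a) * f x + a ^+ 2).
    by rewrite meanD meanZ mean_cst /b -/a; ring.
  by apply: le_mean => x; case/andP: (f01 x) => *; rewrite /g; nra.
have dbl := @double_inj p n p_pr p_odd.
have S_ge0 : 0 <= S by rewrite /S autocorr0; exact: mean_sqr_ge0.
have S_le : 2 * S <= (a * b) ^+ 2.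
  rewrite /S autocorr0; apply: le_trans (mean_autocorr_sqr dbl g0) _.
  by rewrite lerXn2r ?nnegrE ?mean_sqr_ge0// mulr_ge0.
(* Cauchy-Schwarz splits [Q] into the variance of [g] and the mean square of its iterated
   autocorrelation; the latter is bounded by applying [mean_autocorr_sqr] to [autocorr g]. *)
have Q_le : 2 * Q ^+ 2 <= a * b * S ^+ 2.
  have ag0 : mean (autocorr g) = 0 by rewrite mean_autocorr g0 expr0n.
  have S2 : 2 * mean (fun x => autocorr (autocorr g) x ^+ 2) <= S ^+ 2.
    by rewrite /S (autocorr0 (autocorr g)); exact: mean_autocorr_sqr.
  have := mean_CauchySchwarz g (autocorr (autocorr g)); rewrite -/Q => cs.
  apply: le_trans (ler_wpM2l _ cs) _ => //; rewrite mulrCA.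
  apply: ler_pM => //; first exact: mean_sqr_ge0.
  by apply: mulr_ge0 => //; exact: mean_sqr_ge0.
rewrite !T_add_free mean_f' -/a Tf Tf'.
have -> : (2 : R) ^ (1 - (9 + l)%:Z) = 2 * 2^-1 ^+ (9 + l).
  by rewrite expfzDr ?pnatr_eq0// -invr_expz -exprVn.
by apply: common_ineq => //; rewrite /b; ring.
Qed.

(** * Failure of the Sidorenko property, and full rank *)

Lemma not_sidorenko_Phi (R : realType) (p : nat) : ~ sidorenko R (Phi p).
Proof.
move=> /(_ 1%N (fun x => (x == const_mx 1)%:R) isT).
set f := fun x => _.
have f01 x : 0 <= f x <= 1 by rewrite /f ler0n lern1 leq_b1.
move=> /(_ f01); rewrite leNgt => /negP; apply.
(* A nonzero product forces all nine rows to be 1, and the second equation would then read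
   [1 = 0]. *)
have -> : T (Phi p) f = 0.
  rewrite /T /average big1 ?mul0r// => x xsol; apply/eqP/negPn/negP.
  rewrite prodf_seq_neq0 => /allP x1.
  have xrow (i : 'I_9) : row i x = (fun=> const_mx 1) (i : nat).
    have := x1 i (mem_index_enum i); rewrite /= /f pnatr_eq0 eqb0 negbK.
    by move/eqP.
  have /andP[_] := etrans (esym (@mem_solutions_Phi p 1 x (fun=> const_mx 1) xrow)) xsol.
  rewrite subrr add0r subrr add0r => /eqP/rowP/(_ 0); rewrite !mxE => /eqP.
  by rewrite oner_eq0.
apply: exprn_gt0; apply: divr_gt0; last first.
  by rewrite ltr0n; apply/card_gt0P; exists 0; rewrite inE.
rewrite (bigD1 (const_mx 1)) ?inE//= /f eqxx ltr_wpDr ?ltr01//.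
by rewrite sumr_ge0.
Qed.

Lemma is_system_Phi (p : nat) : is_system (Phi p).
Proof.
split=> //.
(* Columns 0 and 4 of [Phi p] form the identity matrix; [B] selects them and is a right inverse. *)
pose B : 'M['F_p]_(9, 2) := \matrix_(i, j) ((i == (4 * j)%N :> nat)%:R).
have PhiB : Phi p *m B = 1%:M.
  apply/matrixP => i j; rewrite mxE !big_ord_recl big_ord0 !mxE /= /bump /=.
  case: i => [[|[|//]] ?]; case: j => [[|[|//]] ?] /=;
    by rewrite ?mulr0 ?mulr1 ?mul0r ?addr0 ?add0r.
by apply/eqP; rewrite -/(row_free _); apply/row_freeP; exists B.
Qed.

Theorem theorem1p4 (R : realType) (p : nat) (p_prime : prime p) (p_odd : odd p) :
  (exists (m t : nat) (M : 'M['F_p]_(m, t)),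
      [/\ is_system M, alon R M & ~ sidorenko R M])
  /\ [/\ is_system (Phi p), alon R (Phi p) & ~ sidorenko R (Phi p)].
Proof.
have PhiP : [/\ is_system (Phi p), alon R (Phi p) & ~ sidorenko R (Phi p)].
  by split; [exact: is_system_Phi | exact: alon_Phi | exact: not_sidorenko_Phi].
by split=> //; exists 2%N, 9%N, (Phi p).
Qed.
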